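(* The Bekič identity holds in each guarded Conway category $(\mathcal C,\blacktriangleright,\dagger)$. That is, for all $f:\blacktriangleright X\times\blacktriangleright Y\times A\to X$ and $g:\blacktriangleright X\times\blacktriangleright Y\times A\to Y$, $$\bigl(\langle f,g\rangle\cdot(\mathsf{can}\times A)\bigr)^\dagger=\langle e_L^\dagger,e_R^\dagger\rangle:A\to X\times Y,$$ where $e_R=g\cdot\langle p_X\cdot f^\dagger,\blacktriangleright Y\times A\rangle:\blacktriangleright Y\times A\to Y$ (with $f^\dagger:\blacktriangleright Y\times A\to X$) and $e_L=f\cdot(\blacktriangleright X\times\langle p_Y\cdot e_R^\dagger,A\rangle):\blacktriangleright X\times A\to X$.
   Context: Notation: objects also denote their identity morphisms; $g\cdot f$ is composition ($f$ first); $\Delta$ is the diagonal; $\mathsf{can}=\langle\blacktriangleright\pi_\ell,\blacktriangleright\pi_r\rangle:\blacktriangleright(X\times Y)\to\blacktriangleright X\times\blacktriangleright Y$, with $\pi_\ell,\pi_r$ the product projections. A guarded Conway category $(\mathcal C,\blacktriangleright,\dagger)$ consists of a category $\mathcal C$ with finite products, an endofunctor $\blacktriangleright:\mathcal C\to\mathcal C$ with a natural transformation $p:\mathrm{Id}\to\blacktriangleright$, and operations $\dagger_{X,Y}:\mathcal C(\blacktriangleright X\times Y,X)\to\mathcal C(Y,X)$, $f\mapsto f^\dagger$, satisfying: ($\dagger$) $f^\dagger=f\cdot(p_X\times Y)\cdot\langle f^\dagger,Y\rangle$ for $f:\blacktriangleright X\times Y\to X$; (P) $f^\dagger\cdot h=(f\cdot(\blacktriangleright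 X\times h))^\dagger$ for $f:\blacktriangleright X\times Y\to X$, $h:Z\to Y$; (C) $(g\cdot f)^\dagger=g\cdot(f\cdot(\blacktriangleright g\times Y))^\dagger$ for $f:\blacktriangleright X\times Y\to Z$, $g:Z\to X$; ($\dagger\dagger$) $f^{\dagger\dagger}=(f\cdot(\Delta\times Y))^\dagger$ for $f:\blacktriangleright X\times\blacktriangleright X\times Y\to X$ (with $f^\dagger:\blacktriangleright X\times Y\to X$ taken in the first component). *)

(* Defs.v *)
Set Implicit Arguments.
Unset Strict Implicit.
Unset Printing Implicit Defensive.

Declare Scope cat_scope.
Delimit Scope cat_scope with cat.
Local Open Scope cat_scope.

Record category := Category {
  obj :> Type;
  hom : obj -> obj -> Type;
  idm : forall X, hom X X;
  comp : forall X Y Z, hom Y Z -> hom X Y -> hom X Z;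
  comp_idl : forall X Y (f : hom X Y), comp (idm Y) f = f;
  comp_idr : forall X Y (f : hom X Y), comp f (idm X) = f;
  comp_assoc : forall W X Y Z (h : hom Y Z) (g : hom X Y) (f : hom W X),
    comp h (comp g f) = comp (comp h g) f
}.
Arguments hom {_} X Y.
Arguments idm {_} X.
Arguments comp {_ X Y Z} g f.

Notation "X ⟶ Y" := (hom X Y) (at level 90, right associativity) : cat_scope.
Notation "g ∘ f" := (comp g f) (at level 50, left associativity) : cat_scope.

(* Finite products are chosen: a terminal object and binary products. *)
Record cartesianCategory := CartesianCategory {
  cart_cat :> category;
  term : cart_cat;
  bang : forall X : cart_cat, X ⟶ term;
  bang_uniq : forall (X : cart_cat) (f : X ⟶ term), f = bang X;
  bprod : cart_cat -> cart_cat -> cart_cat;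
  projl : forall X Y, bprod X Y ⟶ X;
  projr : forall X Y, bprod X Y ⟶ Y;
  pairing : forall Z X Y, (Z ⟶ X) -> (Z ⟶ Y) -> (Z ⟶ bprod X Y);
  projl_pair : forall Z X Y (f : Z ⟶ X) (g : Z ⟶ Y),
    projl X Y ∘ pairing f g = f;
  projr_pair : forall Z X Y (f : Z ⟶ X) (g : Z ⟶ Y),
    projr X Y ∘ pairing f g = g;
  pair_uniq : forall Z X Y (f : Z ⟶ X) (g : Z ⟶ Y) (h : Z ⟶ bprod X Y),
    projl X Y ∘ h = f -> projr X Y ∘ h = g -> h = pairing f g
}.
Arguments term {_}.
Arguments bang {_} X.
Arguments bprod {_} X Y.
Arguments projl {_} X Y.
Arguments projr {_} X Y.
Arguments pairing {_ Z X Y} f g.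

Notation "X × Y" := (bprod X Y) (at level 39, right associativity) : cat_scope.
Notation "⟨ f , g ⟩" := (pairing f g) (at level 0) : cat_scope.

Definition prodm (C : cartesianCategory) (X X' Y Y' : C)
    (f : X ⟶ X') (g : Y ⟶ Y') : X × Y ⟶ X' × Y' :=
  ⟨f ∘ projl X Y, g ∘ projr X Y⟩.

Notation "f ⊗ g" := (prodm f g) (at level 39, right associativity) : cat_scope.

Definition diag (C : cartesianCategory) (X : C) : X ⟶ X × X :=
  ⟨idm X, idm X⟩.

(* Ternary products are nested to the right, so the rebracketing left implicit
   on paper in [Δ × Y] and [can × A] is made explicit by [assoc]. *)
Definition assoc (C : cartesianCategory) (X Y Z : C) :
    (X × Y) × Z ⟶ X × (Y × Z) :=
  ⟨projl X Y ∘ projl (X × Y) Z, ⟨projr X Y ∘ projl (X × Y) Z, projr (X × Y) Z⟩⟩.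

Arguments diag {C} X.
Arguments assoc {C} X Y Z.

Record guardedConwayCategory := GuardedConwayCategory {
  gcc_cat :> cartesianCategory;

  later : gcc_cat -> gcc_cat;
  laterm : forall X Y : gcc_cat, (X ⟶ Y) -> (later X ⟶ later Y);
  laterm_id : forall X : gcc_cat, laterm (idm X) = idm (later X);
  laterm_comp : forall (X Y Z : gcc_cat) (g : Y ⟶ Z) (f : X ⟶ Y),
    laterm (g ∘ f) = laterm g ∘ laterm f;

  point : forall X : gcc_cat, X ⟶ later X;
  point_natural : forall (X Y : gcc_cat) (f : X ⟶ Y),
    point Y ∘ f = laterm f ∘ point X;

  dagger : forall X Y : gcc_cat, (later X × Y ⟶ X) -> (Y ⟶ X);
  dagger_fix : forall (X Y : gcc_cat) (f : later X × Y ⟶ X),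
    dagger f = f ∘ (point X ⊗ idm Y) ∘ ⟨dagger f, idm Y⟩;
  dagger_param : forall (X Y Z : gcc_cat) (f : later X × Y ⟶ X) (h : Z ⟶ Y),
    dagger f ∘ h = dagger (f ∘ (idm (later X) ⊗ h));
  dagger_comp : forall (X Y Z : gcc_cat) (f : later X × Y ⟶ Z) (g : Z ⟶ X),
    dagger (g ∘ f) = g ∘ dagger (f ∘ (laterm g ⊗ idm Y));
  dagger_double : forall (X Y : gcc_cat) (f : later X × (later X × Y) ⟶ X),
    dagger (dagger f) =
      dagger (f ∘ assoc (later X) (later X) Y ∘ (diag (later X) ⊗ idm Y))
}.
Arguments later {_} X.
Arguments laterm {_ X Y} f.
Arguments point {_} X.
Arguments dagger {_ X Y} f.

Notation "▸ X" := (later X) (at level 35, right associativity) : cat_scope.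
Notation "f †" := (dagger f) (at level 2, left associativity, format "f †") : cat_scope.

Definition can (C : guardedConwayCategory) (X Y : C) : ▸(X × Y) ⟶ ▸X × ▸Y :=
  ⟨laterm (projl X Y), laterm (projr X Y)⟩.
Arguments can {C} X Y.

(* Main.v *)
(* Splitting the two occurrences of [w : ▸(X × Y)] in [⟨f, g⟩] makes the left-hand
   side a double dagger.  In both the inner and the outer dagger the recursion
   variable occurs only through [▸π] for a projection [π]; by (C) and (†) such a
   dagger is computed from the dagger of the [π]-component alone. *)
Require Import Defs.

Local Open Scope cat_scope.

Section Products.
Variable C : cartesianCategory.

Lemma pairing_comp (W Z X Y : C) (f : Z ⟶ X) (g : Z ⟶ Y) (h : W ⟶ Z) :
  ⟨f, g⟩ ∘ h = ⟨f ∘ h, g ∘ h⟩.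
Proof.
  apply pair_uniq; rewrite comp_assoc; [now rewrite projl_pair | now rewrite projr_pair].
Qed.

Lemma prodm_pairing (Z X X' Y Y' : C) (f : X ⟶ X') (g : Y ⟶ Y')
    (h : Z ⟶ X) (k : Z ⟶ Y) :
  (f ⊗ g) ∘ ⟨h, k⟩ = ⟨f ∘ h, g ∘ k⟩.
Proof.
  unfold prodm; rewrite pairing_comp, <- !comp_assoc.
  now rewrite projl_pair, projr_pair.
Qed.

End Products.

Section GuardedConway.
Variable C : guardedConwayCategory.

Lemma dagger_unfold (X Y : C) (f : ▸X × Y ⟶ X) :
  f† = f ∘ ⟨point X ∘ f†, idm Y⟩.
Proof.
  refine (eq_trans (dagger_fix f) _).
  now rewrite <- comp_assoc, prodm_pairing, comp_idl.
Qed.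

(** After one unfolding, naturality of [point] moves [q] inside it, and (C) absorbs [q] into the
    dagger. *)
Lemma dagger_laterm (X Y Z : C) (k : ▸X × Y ⟶ Z) (q : Z ⟶ X) :
  (k ∘ (laterm q ⊗ idm Y))† = k ∘ ⟨point X ∘ (q ∘ k)†, idm Y⟩.
Proof.
  rewrite dagger_unfold, <- comp_assoc, prodm_pairing, comp_idl, comp_assoc.
  now rewrite <- point_natural, <- comp_assoc, <- dagger_comp.
Qed.

(** Exposes the diagonal that (††) needs: the first copy feeds [projl], the second [projr]. *)
Lemma can_split (X Y A : C) :
  assoc (▸X) (▸Y) A ∘ (can X Y ⊗ idm A) =
  (idm (▸X) ⊗ (laterm (projr X Y) ⊗ idm A)) ∘
  (laterm (projl X Y) ⊗ idm (▸(X × Y) × A)) ∘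
  assoc (▸(X × Y)) (▸(X × Y)) A ∘ (diag (▸(X × Y)) ⊗ idm A).
Proof.
  unfold assoc, prodm, can, diag.
  repeat (rewrite ?pairing_comp, <- ?comp_assoc, ?projl_pair, ?projr_pair,
    ?comp_idl, ?comp_idr).
  reflexivity.
Qed.

End GuardedConway.

Theorem proposition3p10 (C : guardedConwayCategory) (X Y A : C)
    (f : ▸X × (▸Y × A) ⟶ X) (g : ▸X × (▸Y × A) ⟶ Y) :
  let eR : ▸Y × A ⟶ Y := g ∘ ⟨point X ∘ f†, idm (▸Y × A)⟩ in
  let eL : ▸X × A ⟶ X := f ∘ (idm (▸X) ⊗ ⟨point Y ∘ eR†, idm A⟩) in
  (⟨f, g⟩ ∘ assoc (▸X) (▸Y) A ∘ (can X Y ⊗ idm A))† = ⟨eL†, eR†⟩.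
Proof.
  intros eR eL.
  set (r := laterm (projr X Y) ⊗ idm A).
  (* The pair with its [▸X] input solved by [f†]; only [▸Y × A] remains. *)
  set (k := ⟨f, g⟩ ∘ ⟨point X ∘ f†, idm (▸Y × A)⟩).
  assert (Hk : k = ⟨f†, eR⟩).
  { unfold k; rewrite pairing_comp.
    now rewrite <- (dagger_unfold _ _ _ f). }
  assert (Hinner : (⟨f, g⟩ ∘ (idm (▸X) ⊗ r) ∘
      (laterm (projl X Y) ⊗ idm (▸(X × Y) × A)))† = k ∘ r).
  (* Here [q] is [projl], leaving the dagger of [f ∘ (idm (▸X) ⊗ r)], which (P) turns into
     [f† ∘ r]. *)
  { rewrite dagger_laterm, comp_assoc, projl_pair, <- dagger_param.
    unfold k; rewrite <- !comp_assoc, prodm_pairing, !pairing_comp.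
    now rewrite <- !comp_assoc, !comp_idl, comp_idr. }
  rewrite <- comp_assoc, can_split; fold r.
  rewrite !comp_assoc, <- dagger_double, Hinner; unfold r.
  (* Now [q] is [projr] and [projr ∘ k] is [eR]. The second component refolds to [eR†]; (P) makes
     the first [eL†]. *)
  rewrite dagger_laterm, Hk, projr_pair, pairing_comp.
  now rewrite <- dagger_unfold, dagger_param.
Qed.
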